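(* (Progress, reaching definitions.) Let $P$ be a program, let $(\beta_{\bullet l},\beta_{l\bullet})_{l}$ be the reaching definitions analysis result for $P$ (the least solution of the dataflow equations given in the context), let $\rightarrow$ be the standard execution relation of $P$ and $\Rightarrow$ the reaching-definitions augmented execution relation of $P$. For all labels $l,l'$ and states $\sigma,\sigma'$: if $\langle l,\sigma\rangle\rightarrow\langle l',\sigma'\rangle$, then $\langle l,\sigma,\beta_{\bullet l}\rangle\Rightarrow\langle l',\sigma',\beta_{\bullet l'}\rangle$.
   Context: Language. $N$ is the set of integers, $T=\{\mathbf{true},\mathbf{false}\}$, $V$ a set of variables, $L$ a set of labels. Arithmetic expressions $E$: $e::=n\mid v\mid e_0+e_1\mid e_0-e_1\mid e_0\times e_1$ ($n\in N$, $v\in V$). Boolean expressions $B$: $b::=\mathbf{true}\mid\mathbf{false}\mid e_0=e_1\mid e_0\le e_1\mid\mathbf{not}\,b\mid b_0\,\mathbf{and}\,b_1\mid b_0\,\mathbf{or}\,b_1$. Commands: $c::=\mathbf{skip}\mid v:=e\mid\mathbf{if}\,b\,\mathbf{then}\,g\mid\mathbf{goto}\,g\mid\mathbf{halt}\mid\mathbf{done}$ ($g\in L$). A program $P$ is a sequence of labeled commands $l:c$ with pairwise distinct labels; $\mathbf{first}(P)$ is the label of the first command to execute; $\mathbf{next}(l)$ is the label of the next command after $l$ in the sequential execution order, with $\mathbf{next}(l)=g$ if $l:\mathbf{goto}\,g\in P$. If $l:\mathbf{halt}\in P$ then $\mathbf{next}(l):\mathbf{done}\in P$. Branch targets $g$,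 and $\mathbf{next}(l)$ for each assignment, $\mathbf{skip}$, $\mathbf{if}$ or $\mathbf{halt}$ command at $l$, are labels of $P$. Successors: $\mathbf{succ}(l)=\{\mathbf{next}(l)\}$ for assignment, $\mathbf{skip}$, $\mathbf{halt}$; $\{g\}$ for $\mathbf{goto}\,g$; $\{\mathbf{next}(l),g\}$ for $\mathbf{if}\,b\,\mathbf{then}\,g$; $\emptyset$ for $\mathbf{done}$. Predecessors: $\mathbf{pred}(l)=\{g: l\in\mathbf{succ}(g)\}$. Standard semantics. A state is a partial function $\sigma:V\rightharpoonup N$ with domain $\mathrm{dom}\,\sigma$. The evaluation relations $\langle e,\sigma\rangle\rightarrow n$ and $\langle b,\sigma\rangle\rightarrow t$ are the least relations with: constants evaluate to themselves; $\langle v,\sigma\rangle\rightarrow\sigma(v)$ if $v\in\mathrm{dom}\,\sigma$; a compound expression evaluates to the result of applying its operator to the values of all of its immediate subexpressions, provided all of these evaluate (no short-circuiting). The relation $\langle l,\sigma\rangle\rightarrow\langle l',\sigma'\rangle$ is the least relation with: if $l:v:=e\in P$ and $\langle e,\sigma\rangle\rightarrow n$, then $\langle l,\sigma\rangle\rightarrow\langle\mathbf{next}(l),\sigma[v\mapsto n]\rangle$; if $l:\mathbf{if}\,b\,\mathbf{then}\,g\in P$, then $\langle l,\sigma\rangle\rightarrow\langle g,\sigma\rangle$ when $\langle b,\sigma\rangle\rightarrow\mathbf{true}$ and $\langle l,\sigma\rangle\rightarrow\langle\mathbf{next}(l),\sigma\rangle$ when $\langle b,\sigma\rangle\rightarrow\mathbf{false}$;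 if $l:\mathbf{goto}\,g\in P$, then $\langle l,\sigma\rangle\rightarrow\langle g,\sigma\rangle$; if $l:\mathbf{skip}\in P$, or $l:\mathbf{halt}\in P$ and $\mathbf{next}(l):\mathbf{done}\in P$, then $\langle l,\sigma\rangle\rightarrow\langle\mathbf{next}(l),\sigma\rangle$. Reaching-definitions augmented semantics. The history variable is a function $\pi:V\to\mathcal{P}(L)$; these are ordered by $\pi_1\le\pi_2$ iff $\pi_1(v)\subseteq\pi_2(v)$ for all $v\in V$, with join $(\pi_1\lor\pi_2)(v)=\pi_1(v)\cup\pi_2(v)$. Evaluation $\langle e,\sigma,\pi\rangle\Rightarrow n$, $\langle b,\sigma,\pi\rangle\Rightarrow t$ is defined by exactly the standard rules with $\pi$ carried along unchanged. The relation $\langle l,\sigma,\pi\rangle\Rightarrow\langle l',\sigma',\pi'\rangle$ is the least relation with: if $l:v:=e\in P$ and $\langle e,\sigma,\pi\rangle\Rightarrow n$, then $\langle l,\sigma,\pi\rangle\Rightarrow\langle\mathbf{next}(l),\sigma[v\mapsto n],\pi[v\mapsto\{l\}]\rangle$; for $\mathbf{if}$, $\mathbf{goto}$, $\mathbf{skip}$, $\mathbf{halt}$ the rules are the standard ones with evaluation $\Rightarrow$ in place of $\rightarrow$ and $\pi$ passed through unchanged; and (upward closure) if $\langle l,\sigma,\pi\rangle\Rightarrow\langle l',\sigma',\pi'\rangle$ and $\pi'\le\pi''$, then $\langle l,\sigma,\pi\rangle\Rightarrow\langle l',\sigma',\pi''\rangle$. Reaching definitions analysis. $\beta_{\bullet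 l},\beta_{l\bullet}:V\to\mathcal{P}(L)$, for $l$ ranging over the labels of $P$, are obtained as the least solution (componentwise under $\le$) of the following system of forward dataflow equations, all of which are required to hold: (1) $\beta_{\bullet\mathbf{first}(P)}=\lambda v.\emptyset$; (2) $\beta_{\bullet l}=\bigvee_{g\in\mathbf{pred}(l)}\beta_{g\bullet}$ for each $l:c\in P$ (an empty join being $\lambda v.\emptyset$); (3) $\beta_{l\bullet}=f(l,\beta_{\bullet l})$ for each $l:c\in P$, where the transfer function is $f(l,\beta)=\beta[v\mapsto\{l\}]$ if $l:v:=e\in P$ and $f(l,\beta)=\beta$ otherwise. *)

(* Defs.v *)
From HB Require Import structures.
From mathcomp Require Import all_boot all_order all_algebra.
From mathcomp Require Import boolp classical_sets.

Set Implicit Arguments.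
Unset Strict Implicit.
Unset Printing Implicit Defensive.

Import Order.TTheory GRing.Theory Num.Theory.

Local Open Scope classical_set_scope.
Local Open Scope ring_scope.

Inductive aexp (V : Type) : Type :=
| ANum of int
| AVar of V
| AAdd of aexp V & aexp V
| ASub of aexp V & aexp V
| AMul of aexp V & aexp V.
Arguments ANum {V}.

Inductive bexp (V : Type) : Type :=
| BTrue
| BFalse
| BEq of aexp V & aexp V
| BLe of aexp V & aexp V
| BNot of bexp V
| BAnd of bexp V & bexp V
| BOr of bexp V & bexp V.
Arguments BTrue {V}.
Arguments BFalse {V}.

Inductive cmd (V L : Type) : Type :=
| CSkip
| CAssign of V & aexp V
| CIf of bexp V & L
| CGoto of L
| CHalt
| CDone.
Arguments CSkip {V L}.
Arguments CAssign {V L}.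
Arguments CIf {V L}.
Arguments CGoto {V L}.
Arguments CHalt {V L}.
Arguments CDone {V L}.

Lemma aexp_comparable (V : eqType) : comparable (aexp V).
Proof. rewrite /comparable /decidable; decide equality; exact: eq_comparable. Qed.

HB.instance Definition _ (V : eqType) :=
  hasDecEq.Build (aexp V) (compareP (@aexp_comparable V)).

Lemma bexp_comparable (V : eqType) : comparable (bexp V).
Proof. rewrite /comparable /decidable; decide equality; exact: eq_comparable. Qed.

HB.instance Definition _ (V : eqType) :=
  hasDecEq.Build (bexp V) (compareP (@bexp_comparable V)).

Lemma cmd_comparable (V L : eqType) : comparable (cmd V L).
Proof. rewrite /comparable /decidable; decide equality; exact: eq_comparable. Qed.

HB.instance Definition _ (V L : eqType) :=
  hasDecEq.Build (cmd V L) (compareP (@cmd_comparable V L)).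

Definition cmd_labels (V L : eqType) (code : seq (L * cmd V L)) : seq L :=
  [seq lc.1 | lc <- code].

(* [nextl] is the sequential execution order, a datum of the program: it need
   not follow the order of [code].  It is total, but its values at labels of
   [done] commands and at labels outside of the program are never used. *)
Record program (V L : eqType) : Type := Program {
  code : seq (L * cmd V L);
  firstl : L;
  nextl : L -> L;
  uniq_labels : uniq (cmd_labels code);
  firstl_label : firstl \in cmd_labels code;
  nextl_goto : forall l g, (l, CGoto g) \in code -> nextl l = g;
  nextl_halt : forall l, (l, CHalt) \in code -> (nextl l, CDone) \in code;
  goto_label : forall l g, (l, CGoto g) \in code -> g \in cmd_labels code;
  if_label : forall l b g, (l, CIf b g) \in code -> g \in cmd_labels code;
  nextl_label : forall l c, (l, c) \in code ->
    match c with
    | CSkip | CAssign _ _ | CIf _ _ | CHalt => nextl l \in cmd_labels code : Prop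
    | CGoto _ | CDone => True
    end
}.

Definition labels (V L : eqType) (P : program V L) : seq L :=
  cmd_labels (code P).

Definition succl (V L : eqType) (P : program V L) (l : L) : set L :=
  [set l' | exists2 c, (l, c) \in code P &
     match c with
     | CSkip | CAssign _ _ | CHalt => l' = nextl P l
     | CIf _ g => l' = nextl P l \/ l' = g
     | CGoto g => l' = g
     | CDone => False
     end].

Definition predl (V L : eqType) (P : program V L) (l : L) : set L :=
  [set g | succl P g l].

Definition cmd_at (V L : eqType) (P : program V L) (l : L) : option (cmd V L) :=
  ohead [seq lc.2 | lc <- code P & lc.1 == l].

Lemma cmd_atE (V L : eqType) (P : program V L) (l : L) (c : cmd V L) :
  (cmd_at P l == Some c) = ((l, c) \in code P).
Proof.
rewrite /cmd_at; have := uniq_labels P; rewrite /cmd_labels.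
elim: (code P) => [//|[k d] s IHs] /= /andP[kNs us].
rewrite inE xpair_eqE [l == k]eq_sym; case: (eqVneq k l) => [kl|_] /=; last exact: IHs.
rewrite (_ : (l, c) \in s = false) ?orbF; last first.
  apply/negP => lcs; move/negP: kNs; apply; rewrite kl.
  by apply/mapP; exists (l, c).
by apply/eqP/eqP => [[]|->].
Qed.

(* Partial functions, with domain the variables not mapped to [None]. *)
Definition state (V : Type) : Type := V -> option int.

Definition upd (V : eqType) (A : Type) (f : V -> A) (v : V) (a : A) : V -> A :=
  [eta f with v |-> a].

Inductive aeval (V : Type) (s : state V) : aexp V -> int -> Prop :=
| aeval_num n : aeval s (ANum n) n
| aeval_var v n : s v = Some n -> aeval s (AVar v) n
| aeval_add e0 e1 n0 n1 : aeval s e0 n0 -> aeval s e1 n1 ->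
    aeval s (AAdd e0 e1) (n0 + n1)
| aeval_sub e0 e1 n0 n1 : aeval s e0 n0 -> aeval s e1 n1 ->
    aeval s (ASub e0 e1) (n0 - n1)
| aeval_mul e0 e1 n0 n1 : aeval s e0 n0 -> aeval s e1 n1 ->
    aeval s (AMul e0 e1) (n0 * n1).

Inductive beval (V : Type) (s : state V) : bexp V -> bool -> Prop :=
| beval_true : beval s BTrue true
| beval_false : beval s BFalse false
| beval_eq e0 e1 n0 n1 : aeval s e0 n0 -> aeval s e1 n1 ->
    beval s (BEq e0 e1) (n0 == n1)
| beval_le e0 e1 n0 n1 : aeval s e0 n0 -> aeval s e1 n1 ->
    beval s (BLe e0 e1) (n0 <= n1)
| beval_not b t : beval s b t -> beval s (BNot b) (~~ t)
| beval_and b0 b1 t0 t1 : beval s b0 t0 -> beval s b1 t1 ->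
    beval s (BAnd b0 b1) (t0 && t1)
| beval_or b0 b1 t0 t1 : beval s b0 t0 -> beval s b1 t1 ->
    beval s (BOr b0 b1) (t0 || t1).

Inductive step (V L : eqType) (P : program V L) :
    L -> state V -> L -> state V -> Prop :=
| step_assign l v e n s : (l, CAssign v e) \in code P -> aeval s e n ->
    step P l s (nextl P l) (upd s v (Some n))
| step_if_true l b g s : (l, CIf b g) \in code P -> beval s b true ->
    step P l s g s
| step_if_false l b g s : (l, CIf b g) \in code P -> beval s b false ->
    step P l s (nextl P l) s
| step_goto l g s : (l, CGoto g) \in code P -> step P l s g s
| step_skip l s : (l, CSkip) \in code P -> step P l s (nextl P l) s
| step_halt l s : (l, CHalt) \in code P -> (nextl P l, CDone) \in code P ->
    step P l s (nextl P l) s.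

Definition history (V L : Type) : Type := V -> set L.

Definition hist_le (V L : Type) (p1 p2 : history V L) : Prop :=
  forall v, p1 v `<=` p2 v.

Inductive haeval (V L : Type) (s : state V) (p : history V L) :
    aexp V -> int -> Prop :=
| haeval_num n : haeval s p (ANum n) n
| haeval_var v n : s v = Some n -> haeval s p (AVar v) n
| haeval_add e0 e1 n0 n1 : haeval s p e0 n0 -> haeval s p e1 n1 ->
    haeval s p (AAdd e0 e1) (n0 + n1)
| haeval_sub e0 e1 n0 n1 : haeval s p e0 n0 -> haeval s p e1 n1 ->
    haeval s p (ASub e0 e1) (n0 - n1)
| haeval_mul e0 e1 n0 n1 : haeval s p e0 n0 -> haeval s p e1 n1 ->
    haeval s p (AMul e0 e1) (n0 * n1).

Inductive hbeval (V L : Type) (s : state V) (p : history V L) :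
    bexp V -> bool -> Prop :=
| hbeval_true : hbeval s p BTrue true
| hbeval_false : hbeval s p BFalse false
| hbeval_eq e0 e1 n0 n1 : haeval s p e0 n0 -> haeval s p e1 n1 ->
    hbeval s p (BEq e0 e1) (n0 == n1)
| hbeval_le e0 e1 n0 n1 : haeval s p e0 n0 -> haeval s p e1 n1 ->
    hbeval s p (BLe e0 e1) (n0 <= n1)
| hbeval_not b t : hbeval s p b t -> hbeval s p (BNot b) (~~ t)
| hbeval_and b0 b1 t0 t1 : hbeval s p b0 t0 -> hbeval s p b1 t1 ->
    hbeval s p (BAnd b0 b1) (t0 && t1)
| hbeval_or b0 b1 t0 t1 : hbeval s p b0 t0 -> hbeval s p b1 t1 ->
    hbeval s p (BOr b0 b1) (t0 || t1).

Inductive hstep (V L : eqType) (P : program V L) :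
    L -> state V -> history V L -> L -> state V -> history V L -> Prop :=
| hstep_assign l v e n s p : (l, CAssign v e) \in code P -> haeval s p e n ->
    hstep P l s p (nextl P l) (upd s v (Some n)) (upd p v [set l])
| hstep_if_true l b g s p : (l, CIf b g) \in code P -> hbeval s p b true ->
    hstep P l s p g s p
| hstep_if_false l b g s p : (l, CIf b g) \in code P -> hbeval s p b false ->
    hstep P l s p (nextl P l) s p
| hstep_goto l g s p : (l, CGoto g) \in code P -> hstep P l s p g s p
| hstep_skip l s p : (l, CSkip) \in code P -> hstep P l s p (nextl P l) s p
| hstep_halt l s p : (l, CHalt) \in code P -> (nextl P l, CDone) \in code P ->
    hstep P l s p (nextl P l) s p
| hstep_up l s p l' s' p' p'' : hstep P l s p l' s' p' -> hist_le p' p'' ->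
    hstep P l s p l' s' p''.

Definition transfer (V L : eqType) (P : program V L) (l : L)
    (b : history V L) : history V L :=
  match cmd_at P l with
  | Some (CAssign v _) => upd b v [set l]
  | _ => b
  end.

(* [bin l] and [bout l] are the values before and after [l].  The families are
   total on [L], but only their values at the labels of [P] are constrained,
   here and in the comparison of solutions in [rd_analysis]. *)
Record rd_solution (V L : eqType) (P : program V L)
    (bin bout : L -> history V L) : Prop := RdSolution {
  rd_first : bin (firstl P) = (fun=> set0);
  rd_in : forall l, l \in labels P ->
    bin l = (fun v => \bigcup_(g in predl P l) bout g v);
  rd_out : forall l, l \in labels P -> bout l = transfer P l (bin l)
}.

Definition rd_analysis (V L : eqType) (P : program V L)
    (bin bout : L -> history V L) : Prop :=
  rd_solution P bin bout /\
  forall bin' bout', rd_solution P bin' bout' ->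
    forall l, l \in labels P ->
      hist_le (bin l) (bin' l) /\ hist_le (bout l) (bout' l).

(* Main.v *)
Require Import Defs.
From mathcomp Require Import all_boot.
From mathcomp Require Import classical_sets.

Set Implicit Arguments.
Unset Strict Implicit.
Unset Printing Implicit Defensive.

(** The history never influences evaluation, so every standard step lifts to an
    augmented step whose resulting history is the transfer function applied to
    the initial one, here [bout l].  The inflow equation bounds [bout l] by
    [bin l'] for each successor [l'] of [l], and upward closure of the augmented
    relation concludes. *)

Lemma aeval_haeval (V L : Type) (s : state V) (p : history V L) e n :
  aeval s e n -> haeval s p e n.
Proof. by elim=> *; constructor. Qed.

Lemma beval_hbeval (V L : Type) (s : state V) (p : history V L) b t :
  beval s b t -> hbeval s p b t.
Proof. by elim=> *; constructor=> //; apply: aeval_haeval. Qed.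

Lemma code_labels (V L : eqType) (P : program V L) l c :
  (l, c) \in code P -> l \in labels P.
Proof. exact: (map_f fst). Qed.

(** Labels are pairwise distinct, so membership in [code P] determines what [cmd_at] finds. *)
Lemma transferE (V L : eqType) (P : program V L) l c (p : history V L) :
  (l, c) \in code P ->
  transfer P l p = if c is CAssign v _ then upd p v [set l]%classic else p.
Proof. by rewrite -cmd_atE /transfer => /eqP ->. Qed.

Lemma step_labels (V L : eqType) (P : program V L) l s l' s' :
  step P l s l' s' -> l \in labels P.
Proof. by case=> *; apply: code_labels; eassumption. Qed.

Lemma step_succl (V L : eqType) (P : program V L) l s l' s' :
  step P l s l' s' -> succl P l l'.
Proof. by case=> * /=; eexists; try eassumption; rewrite /=; auto. Qed.

(** Needed because the inflow equation is available only at labels of [P]. *)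
Lemma succl_labels (V L : eqType) (P : program V L) l l' :
  succl P l l' -> l' \in labels P.
Proof.
case=> c lc; have := nextl_label lc.
case: c lc => [|v e|b g|g||] lc nl //=; try by move=> ->.
- by case=> ->; [|apply: if_label lc].
(* [nextl_label] says nothing at a goto. *)
- by move=> ->; apply: goto_label lc.
Qed.

Lemma step_hstep_transfer (V L : eqType) (P : program V L) (p : history V L)
    l s l' s' :
  step P l s l' s' -> hstep P l s p l' s' (transfer P l p).
Proof.
case=> {l s l' s'} [l v e n s lc /(aeval_haeval p) |
  l b g s lc /(beval_hbeval p) | l b g s lc /(beval_hbeval p) |
  l g s lc | l s lc | l s lc]; rewrite (transferE p lc).
- exact: hstep_assign.
- exact: hstep_if_true lc.
- exact: hstep_if_false lc.
- exact: hstep_goto.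
- exact: hstep_skip.
- exact: hstep_halt.
Qed.

(** Since [l] is a predecessor of [l'], [bout l v] is one of the sets united in the inflow equation
    at [l']. *)
Lemma rd_solution_succ (V L : eqType) (P : program V L)
    (bin bout : L -> history V L) l l' :
  rd_solution P bin bout -> succl P l l' -> hist_le (bout l) (bin l').
Proof.
move=> sol ll' v; rewrite (rd_in sol (succl_labels ll')).
exact: (bigcup_sup (F := fun g => bout g v)).
Qed.

Theorem theorem5p9 (V L : eqType) (P : program V L)
    (bin bout : L -> history V L) (Hrd : rd_analysis P bin bout)
    (l l' : L) (s s' : state V) :
  step P l s l' s' -> hstep P l s (bin l) l' s' (bin l').
Proof.
case: Hrd => sol _ st.
(* The edge inequality fixes [bout l] as the history before enlargement. *)
apply: hstep_up (rd_solution_succ sol (step_succl st)).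
rewrite (rd_out sol (step_labels st)); exact: step_hstep_transfer.
Qed.
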